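(* Let $(X,\mathcal{A},\mu)$ be a measure space. For a proper ideal $I$ in $\mathcal{M}(X,\mathcal{A})$, the following statements are equivalent: (1) There exists $Z\in Z[I]$ such that $\mu(Z)=0$. (2) $I$ is dense in $\mathcal{M}(X,\mathcal{A})$ in the $m_\mu$-topology. (3) $I$ is dense in $\mathcal{M}(X,\mathcal{A})$ in the $U_\mu$-topology.
   Context: $X$ is a non-empty set, $\mathcal{A}$ a $\sigma$-algebra on $X$, $\mu:\mathcal{A}\to[0,\infty]$ a measure. $\mathcal{M}(X,\mathcal{A})$ is the commutative ring of all measurable functions $X\to\mathbb{R}$ under pointwise operations. A $\mu$-null set is a set $E\in\mathcal{A}$ with $\mu(E)=0$. A positive unit of $\mathcal{M}(X,\mathcal{A})$ is a $u\in\mathcal{M}(X,\mathcal{A})$ with $u(x)>0$ for all $x\in X$. The $U_\mu$-topology on $\mathcal{M}(X,\mathcal{A})$ has as open base the sets $U_\mu(f,\epsilon)=\{g\in\mathcal{M}(X,\mathcal{A}): \sup_{x\in X\setminus E}|f(x)-g(x)|<\epsilon$ for some $\mu$-null set $E\}$ (supremum taken in $[0,\infty]$), $f\in\mathcal{M}(X,\mathcal{A})$, $\epsilon>0$. The $m_\mu$-topology has as open base the sets $m_\mu(f,u)=\{g\in\mathcal{M}(X,\mathcal{A}):$ there is a $\mu$-null set $E$ with $|f(x)-g(x)|<u(x)$ for all $x\in X\setminus E\}$, $f\in\mathcal{M}(X,\mathcal{A})$, $u$ a positive unit. $Z(f)=\{x\in X: f(x)=0\}$ and $Z[I]=\{Z(f):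 f\in I\}$. *)

(* Defs.v *)
From HB Require Import structures.
From mathcomp Require Import all_boot all_order all_algebra.
From mathcomp Require Import all_classical all_reals all_analysis measurable_realfun.

Set Implicit Arguments.
Unset Strict Implicit.
Unset Printing Implicit Defensive.

Import Order.TTheory GRing.Theory Num.Theory.
Import numFieldNormedType.Exports.

Local Open Scope classical_set_scope.
Local Open Scope ring_scope.

Section definitions.
Context (d : measure_display) (X : measurableType d) (R : realType).
Implicit Types (mu : {measure set X -> \bar R}) (f g u : {mfun X >-> R}).

Definition null_set mu (E : set X) : Prop := measurable E /\ mu E = 0%E.

Definition positive_unit u : Prop := forall x, 0 < u x.

(* [ereal_sup set0] is -oo rather than 0; since [0 < eps] in every use, this
   does not change the sets below when [E = setT]. *)
Definition U_ball mu f (eps : R) : set {mfun X >-> R} :=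
  [set g | exists2 E, null_set mu E &
    (ereal_sup [set `|f x - g x|%:E | x in ~` E] < eps%:E)%E].

Definition m_ball mu f u : set {mfun X >-> R} :=
  [set g | exists2 E, null_set mu E &
    forall x, (~` E) x -> `|f x - g x| < u x].

Definition zero_set f : set X := [set x | f x = 0].

Definition zero_sets (I : {pred {mfun X >-> R}}) : set (set X) :=
  [set zero_set f | f in [set` I]].

(* Aliases of the ring of measurable functions, so that the two topologies can
   be attached to it as canonical structures. *)
Definition mfun_U mu : Type := {mfun X >-> R}.
Definition mfun_m mu : Type := {mfun X >-> R}.

End definitions.

Section topologies.
Context (d : measure_display) (X : measurableType d) (R : realType).
Context (mu : {measure set X -> \bar R}).
Local Notation M := {mfun X >-> R}.

HB.instance Definition _ := Choice.on (mfun_U mu).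
HB.instance Definition _ := Choice.on (mfun_m mu).
HB.instance Definition _ := isPointed.Build (mfun_U mu) (0 : M).
HB.instance Definition _ := isPointed.Build (mfun_m mu) (0 : M).

Let null0 : null_set mu set0.
Proof. by split; [exact: measurable0|exact: measure0]. Qed.

Let nullU E F : null_set mu E -> null_set mu F -> null_set mu (E `|` F).
Proof.
move=> [mE E0] [mF F0]; split; first exact: measurableU.
by rewrite measureU0.
Qed.

Lemma U_ball_center f e : 0 < e -> U_ball mu f e f.
Proof.
move=> e0; exists set0 => //; apply: (@le_lt_trans _ _ 0%E); last by rewrite lte_fin.
by apply: ge_ereal_sup => _ [x _ <-]; rewrite subrr normr0.
Qed.

Lemma U_ball_cover :
  \bigcup_(i in [set i : M * R | 0 < i.2]) (U_ball mu i.1 i.2) = setT.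
Proof.
apply/seteqP; split=> // f _.
by exists (f, 1); [exact: ltr01|exact/U_ball_center/ltr01].
Qed.

Lemma U_ball_sub f e t : U_ball mu f e t ->
  exists2 r, 0 < r & U_ball mu t r `<=` U_ball mu f e.
Proof.
move=> [E nE] sup_lt.
have [r r0 Er] : exists2 r, 0 < r &
    (forall x, (~` E) x -> `|f x - t x| <= e - r).
  move: sup_lt; set s := ereal_sup _ => sup_lt.
  have ub x : (~` E) x -> (`|f x - t x|%:E <= s)%E.
    by move=> Ex; apply: ereal_sup_ubound; exists x.
  case: s sup_lt ub => [s|//|] sup_lt ub.
  - exists (e - s); first by rewrite subr_gt0 -lte_fin.
    by move=> x /ub; rewrite lee_fin subKr.
  - by exists 1 => // x /ub; rewrite leNgt ltNyr.
exists (r / 2); first by rewrite divr_gt0.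
move=> g [F nF]; move=> sup_lt'; exists (E `|` F); first exact: nullU.
apply: (@le_lt_trans _ _ (e - r / 2)%:E); last first.
  by rewrite lte_fin gtrDl oppr_lt0 divr_gt0.
apply: ge_ereal_sup => _ [x EFx <-]; rewrite lee_fin.
have /Er le1 : (~` E) x by move=> Ex; apply: EFx; left.
have Fx : (~` F) x by move=> ?; apply: EFx; right.
have le2 : `|t x - g x| <= r / 2.
  rewrite -lee_fin; apply: le_trans (ltW sup_lt').
  by apply: ereal_sup_ubound; exists x.
apply: le_trans (ler_distD (t x) _ _) _; apply: le_trans (lerD le1 le2) _.
by rewrite [X in _ - X + _]splitr opprD addrA subrK.
Qed.

Lemma U_ball_mono f e e' : e <= e' -> U_ball mu f e `<=` U_ball mu f e'.
Proof.
by move=> ee' g [E nE h]; exists E => //; apply: lt_le_trans h _; rewrite lee_fin.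
Qed.

Lemma U_ball_join (i j : M * R) (t : M) : 0 < i.2 -> 0 < j.2 ->
    U_ball mu i.1 i.2 t -> U_ball mu j.1 j.2 t ->
  exists k : M * R, [/\ 0 < k.2, U_ball mu k.1 k.2 t &
    U_ball mu k.1 k.2 `<=` U_ball mu i.1 i.2 `&` U_ball mu j.1 j.2].
Proof.
move=> i0 j0 /U_ball_sub[r r0 ri] /U_ball_sub[s s0 sj].
have m0 : 0 < Num.min r s by rewrite lt_min r0.
exists (t, Num.min r s); split=> //=; first exact: U_ball_center.
move=> g tg; split; [apply: ri|apply: sj]; apply: U_ball_mono tg;
  by rewrite ge_min lexx ?orbT.
Qed.

Lemma m_ball_center f u : positive_unit u -> m_ball mu f u f.
Proof. by move=> u0; exists set0 => // x _; rewrite subrr normr0. Qed.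

Lemma m_ball_cover : \bigcup_(i in [set i : M * M | positive_unit i.2])
  (m_ball mu i.1 i.2) = setT.
Proof.
apply/seteqP; split=> // f _.
by exists (f, 1 : M); [move=> x; exact: ltr01|apply: m_ball_center => x; exact: ltr01].
Qed.

Lemma m_ball_sub f u t : m_ball mu f u t ->
  exists2 v, positive_unit v & m_ball mu t v `<=` m_ball mu f u.
Proof.
move=> [E [mE E0] tE].
pose w := fun x => (u x - `|f x - t x|) * \1_(~` E) x + \1_E x.
have mw : measurable_fun setT w.
  apply: measurable_funD; last exact: measurable_indic.
  apply: measurable_funM; last by apply: measurable_indic; exact: measurableC.
  apply: measurable_funB => //.
  by apply: measurableT_comp => //; exact: measurable_funB.
exists (mfun_Sub (mem_set mw : w \in mfun)).
  move=> x /=; rewrite /w !indicE in_setC.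
  have [xE|xE] /= := boolP (x \in E); first by rewrite mulr0 add0r.
  rewrite mulr1 addr0 subr_gt0; apply: tE.
  by move=> /mem_set; apply/negP.
move=> g [F nF gF]; exists (E `|` F); first exact: nullU.
move=> x EFx.
have Ex : (~` E) x by move=> Ex; apply: EFx; left.
have /gF : (~` F) x by move=> ?; apply: EFx; right.
rewrite /= /w !indicE in_setC memNset//= mulr1 addr0 ltrBrDl => h.
by apply: le_lt_trans h; exact: ler_distD.
Qed.

Lemma m_ball_join (i j : M * M) (t : M) :
    positive_unit i.2 -> positive_unit j.2 ->
    m_ball mu i.1 i.2 t -> m_ball mu j.1 j.2 t ->
  exists k : M * M, [/\ positive_unit k.2, m_ball mu k.1 k.2 t &
    m_ball mu k.1 k.2 `<=` m_ball mu i.1 i.2 `&` m_ball mu j.1 j.2].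
Proof.
move=> i0 j0 /m_ball_sub[r r0 ri] /m_ball_sub[s s0 sj].
have m0 : positive_unit (min_mfun r s) by move=> x /=; rewrite lt_min r0 s0.
exists (t, min_mfun r s); split=> //=; first exact: m_ball_center.
move=> g [E nE gE]; split; [apply: ri|apply: sj]; exists E => // x /gE /=;
  by rewrite lt_min => /andP[].
Qed.

HB.instance Definition _ := @isBaseTopological.Build (mfun_U mu)
  (mfun_U mu * R)%type [set i | 0 < i.2] (fun i => U_ball mu i.1 i.2)
  U_ball_cover U_ball_join.

HB.instance Definition _ := @isBaseTopological.Build (mfun_m mu)
  (mfun_m mu * mfun_m mu)%type [set i | positive_unit i.2] (fun i => m_ball mu i.1 i.2)
  m_ball_cover m_ball_join.

End topologies.

(* Main.v *)
Require Import Defs.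
From HB Require Import structures.
From mathcomp Require Import all_boot all_order all_algebra.
From mathcomp Require Import all_classical all_reals all_analysis measurable_realfun.

Set Implicit Arguments.
Unset Strict Implicit.
Unset Printing Implicit Defensive.

Import Order.TTheory GRing.Theory Num.Theory.
Import numFieldNormedType.Exports.

Local Open Scope classical_set_scope.
Local Open Scope ring_scope.

(** If [f] lies in [I] and vanishes only on a null set, then every [h] agrees
    almost everywhere with [(h / f) * f], which lies in [I], so [I] meets every
    ball of [m_mu]. The [m_mu]-topology refines the [U_mu]-topology, as positive
    constants are positive units. Finally an element of [I] that is uniformly
    close to [1] off a null set [E] can only vanish on [E]. *)

(** Inversion is continuous on the open set of nonzero reals, and on the remaining singleton
    measurability is immediate. *)
Lemma measurable_inv (R : realType) : measurable_fun setT (@GRing.inv R).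
Proof.
have -> : [set: R] = [set 0] `|` ~` [set 0] by rewrite setUv.
apply/measurable_funU => //; first exact: measurableC.
split; first exact: measurable_fun_set1.
apply: open_continuous_measurable_fun.
  exact/closed_openC/accessible_closed_set1/hausdorff_accessible/Rhausdorff.
by move=> x /set_mem /eqP x0; exact: inv_continuous.
Qed.

Section balls.
Context (d : measure_display) (X : measurableType d) (R : realType).
Context (mu : {measure set X -> \bar R}).
Implicit Types (f g u : {mfun X >-> R}).

Lemma m_ball_open f u : positive_unit u -> open (m_ball mu f u : set (mfun_m mu)).
Proof.
move=> u0; exists [set (f, u)]; first by move=> _ ->.
by rewrite bigcup_set1.
Qed.

Lemma U_ball_open f e : 0 < e -> open (U_ball mu f e : set (mfun_U mu)).
Proof.
move=> e0; exists [set (f, e)]; first by move=> _ ->.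
by rewrite bigcup_set1.
Qed.

(** A basic set containing [f] need not be centred at [f]; [m_ball_sub] provides a smaller ball that
    is. *)
Lemma open_m_ball (O : set (mfun_m mu)) f : open O -> O f ->
  exists2 u, positive_unit u & m_ball mu f u `<=` O.
Proof.
move=> [D Dpos <-] [[t v] Dtv /m_ball_sub[u u0 uO]].
by exists u => // g /uO tg; exists (t, v).
Qed.

Lemma open_U_ball (O : set (mfun_U mu)) f : open O -> O f ->
  exists2 e, 0 < e & U_ball mu f e `<=` O.
Proof.
move=> [D Dpos <-] [[t r] Dtr /U_ball_sub[e e0 eO]].
by exists e => // g /eO tg; exists (t, r).
Qed.

(** Pointwise strict bounds by [r] only give a supremum at most [r], hence the gap between [r] and
    [e]. *)
Lemma m_ball_cst_sub_U_ball f (r e : R) : r < e ->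
  m_ball mu f (cst r) `<=` U_ball mu f e.
Proof.
move=> re g [E nE fgE]; exists E => //; apply: (@le_lt_trans _ _ r%:E).
  by apply: ge_ereal_sup => _ [x /fgE/ltW fg <-]; rewrite lee_fin.
by rewrite lte_fin.
Qed.

Lemma U_ballW f g e : U_ball mu f e g ->
  exists2 E, Defs.null_set mu E & forall x, (~` E) x -> `|f x - g x| < e.
Proof.
move=> [E nE fge]; exists E => // x Ex; rewrite -lte_fin.
by apply: le_lt_trans fge; apply: ereal_sup_ubound; exists x.
Qed.

Lemma measurable_zero_set f : measurable (zero_set f).
Proof. exact: (measurable_funPTI f (measurable_set1 0)). Qed.

(** The witness is [g / f], a total function since [0^-1 = 0]. *)
Lemma mul_div_off_zero_set f g :
  exists h : {mfun X >-> R}, forall x, (~` zero_set f) x -> (h * f) x = g x.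
Proof.
have mh : measurable_fun setT (fun x => g x / f x).
  by apply: measurable_funM => //; apply: measurableT_comp => //; exact: measurable_inv.
exists (mfun_Sub (mem_set mh : _ \in mfun)) => x /eqP fx0.
by rewrite -[RHS](divfK fx0).
Qed.

End balls.

Theorem theorem5p12 (d : measure_display) (X : measurableType d)
    (R : realType) (mu : {measure set X -> \bar R})
    (I : {pred {mfun X >-> R}}) (properI : idealr_closed I) :
  [<-> exists2 Z, zero_sets I Z & mu Z = 0%E;
       dense ([set` I] : set (mfun_m mu));
       dense ([set` I] : set (mfun_U mu))].
Proof.
tfae.
- move=> [_ [f fI <-] f0] O [g Og] oO.
  have [u u0 uO] := open_m_ball oO Og.
  have [h hf] := mul_div_off_zero_set f g.
  have [I0 _ Ilin] := properI.
  (* [Ilin] concerns combinations [a * u + v], so the product is read as [h * f + 0]. *)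
  exists (h * f); split; last by rewrite /= -[_ * _]addr0; exact: Ilin.
  apply: uO; exists (zero_set f) => [|x /hf ->].
    by split; first exact: measurable_zero_set.
  by rewrite subrr normr0.
- move=> Idense O [g Og] oO.
  have [e e0 eO] := open_U_ball oO Og.
  (* Halving [e] keeps the supremum strictly below [e]. *)
  have e20 : positive_unit (cst (e / 2) : {mfun X >-> R}).
    by move=> x; rewrite divr_gt0.
  have [|f [gf fI]] := Idense _ _ (m_ball_open mu g e20).
    by exists g; exact: m_ball_center.
  exists f; split=> //; apply: eO; apply: m_ball_cst_sub_U_ball gf.
  by rewrite gtr_pMr// invf_lt1// ltr1n.
- move=> Idense.
  have [|f [/U_ballW[E [mE E0] fE] fI]] := Idense _ _ (U_ball_open mu 1 ltr01).
    by exists 1; exact/U_ball_center/ltr01.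
  exists (zero_set f); first by exists f.
  apply: (subset_measure0 (measurable_zero_set f) mE _ E0) => x fx0.
  (* A zero of [f] outside [E] would give [1 < 1]. *)
  apply: contrapT => /fE; rewrite fx0 subr0 /=.
  by rewrite normr1 ltxx.
Qed.
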